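(* Let $(X; f_0,f_1,\dots,f_{n-1})$ be an iterated function system on a compact metric space $(X,d)$ such that $d(f_i(x),f_i(y)) = r\,d(x,y)$ for all $x,y\in X$ and all $0\le i\le n-1$, where $0<r<1$. Let $1<\beta<n$ and let $E_\beta$ be the $\beta$-attractor of this system. Assume the separation condition $$f_i(E_\beta)\cap f_j(E_\beta)\cap E_\beta=\emptyset\quad\text{for all } i\neq j .$$ Then $$\dim_H(E_\beta)=\frac{\log\beta}{-\log r},$$ and, with $s=\dim_H(E_\beta)$, the $s$-dimensional Hausdorff measure of $E_\beta$ is positive and finite.
   Context: An iterated function system $(X;f_0,\dots,f_{n-1})$, $n\ge 2$, consists of a (nonempty) compact metric space $X$ and contractions $f_i:X\to X$. Let $\Sigma_n=\{0,1,\dots,n-1\}^{\mathbb N}$ with the product topology, and define $\phi:\Sigma_n\to X$ by $\phi(i_1,i_2,\dots)=\lim_{k\to\infty} f_{i_1}\circ\cdots\circ f_{i_k}(x)$; the limit exists and is independent of $x\in X$. $\beta$-expansions: for a real number $\beta>1$ let $T_\beta:[0,1)\to[0,1)$, $T_\beta x=\beta x-\lfloor\beta x\rfloor$. For $x\in[0,1)$ put $a_k=\lfloor \beta\, T_\beta^{k-1}x\rfloor$ for $k\ge1$; then $x=\sum_{k\ge1}a_k\beta^{-k}$, and the sequence $(a_1,a_2,\dots)$ is called the $\beta$-expansion of $x$. The $\beta$-shift $\Sigma_\beta$ is the closure, in the product topology, of the set of all sequences that are the $\beta$-expansion of some $x\in[0,1)$. For $\beta\le n$ one has $\Sigma_\beta\subseteq\Sigma_n$,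 and the $\beta$-attractor of the iterated function system is $E_\beta=\phi(\Sigma_\beta)$. $\dim_H$ denotes Hausdorff dimension and Hausdorff measure is the usual one: $\mathcal H^s(E)=\lim_{\delta\to0}\inf\{\sum_i |U_i|^s : \{U_i\} \text{ a countable cover of } E \text{ with diameters } |U_i|\le\delta\}$. *)

(* Defs.v *)
From HB Require Import structures.
From mathcomp Require Import all_boot all_order all_algebra.
From mathcomp Require Import all_classical all_reals all_analysis.
Set Implicit Arguments.
Unset Strict Implicit.
Unset Printing Implicit Defensive.
Import Order.TTheory GRing.Theory Num.Theory.
Import numFieldTopology.Exports numFieldNormedType.Exports.
Local Open Scope classical_set_scope.
Local Open Scope ring_scope.

(* Sequences are indexed from 0: the digit a_k is [beta_expansion beta x k.-1],
   and the symbol i_k of a code is [w k.-1]. *)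

Definition beta_transform (R : realType) (beta x : R) : R :=
  beta * x - (Num.floor (beta * x))%:~R.

(* On [0, 1) the truncated number is nonnegative, so [Num.truncn] is its
   integer part, as a natural number. *)
Definition beta_expansion (R : realType) (beta x : R) : nat -> nat :=
  fun k => Num.truncn (beta * iter k (beta_transform beta) x).

(* Closure in nat^nat, each factor discrete. For beta <= n it is the same as the
   closure in {0, ..., n-1}^nat, which is closed in nat^nat. *)
Definition beta_shift (R : realType) (beta : R) : set {ptws nat -> nat} :=
  closure ([set beta_expansion beta x | x in `[0, 1[] : set {ptws nat -> nat}).

Section IFS.
Context {R : realType} {X : metricType R} {n : nat}.
Implicit Types (f : 'I_n -> X -> X) (w : nat -> 'I_n).

Fixpoint ifs_comp f w (k : nat) : X -> X :=
  if k is k'.+1 then ifs_comp f w k' \o f (w k') else id.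

(* For contractions of a compact space the limit exists and does not depend on
   the starting point x0, which is also the default value of [xget]. *)
Definition coding_map f (x0 : X) w : X :=
  xget x0 [set y | ifs_comp f w k x0 @[k --> \oo] --> y].

Definition beta_attractor f (x0 : X) (beta : R) : set X :=
  coding_map f x0 @`
    [set w : nat -> 'I_n | beta_shift beta (fun k => w k : nat)].

End IFS.

Section Hausdorff.
Context {R : realType} {X : metricType R}.
Local Open Scope ereal_scope.
Implicit Types (A E : set X) (s d : R).

(* -oo when A is empty *)
Definition diam A : \bar R :=
  ereal_sup [set (mdist p.1 p.2)%:E | p in A `*` A].

(* |A| ^ s, with the conventions |set0| ^ s = 0 for all s (so that empty sets
   may pad a finite cover) and 0 ^ 0 = 1 for the diameter of a singleton. *)
Definition diam_pow s A : \bar R :=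
  if A == set0 then 0 else diam A `^ s.

Definition hausdorff_premeasure s d E : \bar R :=
  ereal_inf [set \sum_(0 <= i <oo) diam_pow s (U i) | U in
    [set U : nat -> set X |
      E `<=` \bigcup_i U i /\ forall i, diam (U i) <= d%:E]].

Definition hausdorff_measure s E : \bar R :=
  lim (hausdorff_premeasure s d E @[d --> 0^'+]).

Definition hausdorff_dim E : \bar R :=
  ereal_inf [set s%:E | s in [set s | (0 <= s)%R /\ hausdorff_measure s E = 0]].

End Hausdorff.

(* Main.v *)
Require Import Defs.
From HB Require Import structures.
From mathcomp Require Import all_boot all_order all_algebra.
From mathcomp Require Import all_classical all_reals all_analysis.
From mathcomp Require Import ring lra.
Import Order.TTheory GRing.Theory Num.Theory.
Import numFieldTopology.Exports numFieldNormedType.Exports.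
Local Open Scope classical_set_scope.
Local Open Scope ring_scope.

(** Write [E] for the attractor, [phi] for the coding map and
    [s = ln beta / - ln r], so that [r `^ s = beta^-1]. The theorem holds because
    [phi] turns the beta-shift into [E] with controlled distortion, while the
    beta-expansions turn [0, 1) into the beta-shift.

    Distances in [E]. The beta-shift is stable under dropping digits, and
    [phi w = f (w 0) (phi (shift w))]; hence the points of [E] whose code starts
    with [i] lie in the compact set [f i @` E `&` E]. By separation these sets
    are pairwise disjoint, so they are at mutual distance at least some [e > 0]
    ([separation_dist]). As the maps are similarities, two codes that first
    differ at position [k] have images at distance at least [r ^+ k * e]
    (and at most [r ^+ k * D], with [D] a bound for the distances in the space).

    Lower bound. If the expansions of [x] and [y] first differ at position [k],
    then [`|x - y| <= beta ^- k = (r ^+ k) `^ s], which is at most a constant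
    times the [s]-th power of the distance of the two coded points of [E]
    ([expansion_holder]). Thus every cover of [E] pulls back to a cover of [0, 1)
    by sets whose lengths are controlled by the [s]-th powers of the diameters,
    and subadditivity of Lebesgue measure bounds the sum of these powers away
    from 0 ([hausdorff_premeasure_ge]).

    Upper bound. The expansions have at most [C * beta ^+ k] prefixes of length
    [k] ([beta_prefixes]), so [E] is covered by that many sets of diameter at most
    [r ^+ k * D]. For an exponent [t] the corresponding sum is at most a constant
    times [(beta * r `^ t) ^+ k], which stays bounded for [t = s] and tends to 0
    for [t > s] ([premeasure_attractor_le]). *)

Set Implicit Arguments.
Unset Strict Implicit.

(** * Beta-expansions *)

Section BetaExpansions.
Context {R : realType} (beta : R) (beta_gt1 : 1 < beta).

Let beta_gt0 : 0 < beta. Proof. exact: lt_trans beta_gt1. Qed.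

Lemma beta_transformE (x : R) : 0 <= x ->
  beta_transform beta x = beta * x - (Num.truncn (beta * x))%:R.
Proof.
move=> x0; rewrite /beta_transform truncn_floor mulr_ge0 ?(ltW beta_gt0)//.
by rewrite pmulrn gez0_abs// floor_ge0 mulr_ge0// ltW.
Qed.

Lemma beta_transform_itv (x : R) : 0 <= beta_transform beta x < 1.
Proof.
have /andP[fl fu] := floor_itv (beta * x).
by rewrite /beta_transform subr_ge0 fl ltrBlDl -[1]/(1%:~R) -intrD.
Qed.

Lemma iter_beta_transform_itv (x : R) k : 0 <= x < 1 ->
  0 <= iter k (beta_transform beta) x < 1.
Proof. by case: k => [//|k] _; apply: beta_transform_itv. Qed.

Lemma beta_expansionS (x : R) k :
  beta_expansion beta x k.+1 = beta_expansion beta (beta_transform beta x) k.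
Proof. by rewrite /beta_expansion iterSr. Qed.

Lemma beta_expansion_ltn (n : nat) (x : R) k : beta < n%:R -> 0 <= x < 1 ->
  (beta_expansion beta x k < n)%N.
Proof.
move=> bn x01; have /andP[y0 y1] := iter_beta_transform_itv k x01.
rewrite /beta_expansion truncn_lt_nat ?mulr_ge0 ?(ltW beta_gt0)//.
by apply: lt_trans bn; rewrite -ltr_pdivlMl// mulVf ?gt_eqF.
Qed.

(** Equal digits cancel in the difference of two orbits, on which the
    transformation then acts as multiplication by [beta]. *)
Lemma iter_beta_transformB (x y : R) k : 0 <= x < 1 -> 0 <= y < 1 ->
    (forall i, (i < k)%N -> beta_expansion beta x i = beta_expansion beta y i) ->
  iter k (beta_transform beta) x - iter k (beta_transform beta) y =
    beta ^+ k * (x - y).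
Proof.
move=> x01 y01; elim: k => [|k IH] xy; first by rewrite expr0 mul1r.
have /andP[x0 _] := iter_beta_transform_itv k x01.
have /andP[y0 _] := iter_beta_transform_itv k y01.
rewrite /= !beta_transformE//.
have := xy k (ltnSn k); rewrite /beta_expansion => ->.
rewrite exprS -mulrA -IH; last by move=> i ik; apply: xy; rewrite ltnS ltnW.
by ring.
Qed.

(** The two orbits are still in [0, 1) after [k] steps, while their difference
    has been multiplied by [beta ^+ k]. *)
Lemma beta_expansion_dist (x y : R) k : 0 <= x < 1 -> 0 <= y < 1 ->
    (forall i, (i < k)%N -> beta_expansion beta x i = beta_expansion beta y i) ->
  `|x - y| <= beta ^- k.
Proof.
move=> x01 y01 xy.
rewrite -[leRHS]mul1r ler_pdivlMr ?exprn_gt0//.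
rewrite -[X in _ * X]ger0_norm ?exprn_ge0 ?(ltW beta_gt0)// -normrM mulrC.
rewrite -iter_beta_transformB//.
have /andP[x0 x1] := iter_beta_transform_itv k x01.
have /andP[y0 y1] := iter_beta_transform_itv k y01.
by rewrite ler_norml; lra.
Qed.

(** Counting the prefixes of all [x < z] makes the induction close: with
    [m] the integer part of [beta * z], a prefix of length [k.+1] is either a
    digit [j < m] followed by a prefix of any point of [0, 1), or [m] followed
    by a prefix of a point below [beta * z - m]. *)
Lemma beta_prefixes (k : nat) (z : R) : 0 <= z <= 1 ->
  exists2 L : seq (seq nat),
    (size L)%:R <= z * (beta / (beta - 1)) * (beta ^+ k - 1) + 1 &
    forall x, 0 <= x < z -> mkseq (beta_expansion beta x) k \in L.
Proof.
have bm : 0 < beta - 1 by rewrite subr_gt0.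
elim: k z => [|k IH] z /andP[z0 z1].
  by exists [:: [::]] => //=; rewrite expr0 subrr mulr0 add0r.
pose m := Num.truncn (beta * z).
have bz0 : 0 <= beta * z by rewrite mulr_ge0 ?(ltW beta_gt0).
have /andP[m1 m2] := truncn_itv bz0; rewrite -/m -natr1 in m1 m2.
have [|L1 sL1 hL1] := IH 1; first by rewrite ler01 lexx.
have [|L2 sL2 hL2] := IH (beta * z - m%:R); first by lra.
exists ([seq j :: u | j <- iota 0 m, u <- L1] ++ [seq m :: u | u <- L2]).
  rewrite size_cat size_allpairs size_iota size_map natrD natrM.
  have H1 : m%:R * (size L1)%:R <=
      m%:R * (1 * (beta / (beta - 1)) * (beta ^+ k - 1) + 1) :> R.
    by rewrite ler_wpM2l.
  apply: (le_trans (lerD H1 sL2)).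
  rewrite [leLHS](_ : _ = beta * z * (beta / (beta - 1)) * (beta ^+ k - 1)
      + m%:R + 1); last by ring.
  rewrite [leRHS](_ : _ = beta * z * (beta / (beta - 1)) * (beta ^+ k - 1)
      + beta * z + 1); last by rewrite exprS; field; lra.
  by rewrite !lerD2r lerD2l.
move=> x /andP[x0 xz].
have bx0 : 0 <= beta * x by rewrite mulr_ge0 ?(ltW beta_gt0).
have /andP[a1 a2] := truncn_itv bx0.
have /andP[t0 t1] := beta_transform_itv x.
have -> : mkseq (beta_expansion beta x) k.+1 = Num.truncn (beta * x) ::
    mkseq (beta_expansion beta (beta_transform beta x)) k.
  rewrite /mkseq /= -[1%N]addn0 iotaDl -map_comp; congr (_ :: _).
  by apply: eq_map => i /=; rewrite add1n beta_expansionS.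
rewrite mem_cat; apply/orP.
have bxz : beta * x < beta * z by rewrite ltr_pM2l.
have [am|ma] := ltnP (Num.truncn (beta * x)) m.
  left; apply/allpairsP; exists (Num.truncn (beta * x),
    mkseq (beta_expansion beta (beta_transform beta x)) k); split => //=.
    by rewrite mem_iota.
  by apply: hL1; rewrite t0.
have am : Num.truncn (beta * x) = m.
  by apply/eqP; rewrite eqn_leq ma andbT; apply: le_truncn; exact: ltW.
right; rewrite am; apply: map_f; apply: hL2.
by rewrite t0 beta_transformE// am ltrD2r.
Qed.

End BetaExpansions.

(** * The beta-shift *)

Section BetaShift.
Context {R : realType} (beta : R).

Lemma nbhs_prefix (c : {ptws nat -> nat}) k :
  nbhs c [set c' : {ptws nat -> nat} | forall i, (i < k)%N -> c' i = c i].
Proof.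
elim: k => [|k IH]; first by apply: filterS filterT.
have ck : nbhs c [set c' : {ptws nat -> nat} | c' k = c k].
  exact: (@proj_continuous _ (fun=> nat) k c _ (discrete_set1 (c k))).
apply: filterS (filterI IH ck) => c' [c1 c2] i.
by rewrite ltnS leq_eqVlt => /orP[/eqP -> //|]; exact: c1.
Qed.

(** A basic neighbourhood in a product of discrete spaces only constrains
    finitely many coordinates, so membership in the closure is a condition on
    prefixes. *)
Lemma beta_shiftP (c : nat -> nat) : beta_shift beta c <->
  forall k, exists2 x : R, 0 <= x < 1 &
    forall i, (i < k)%N -> beta_expansion beta x i = c i.
Proof.
split=> [cc k|H].
  have [_ [[x x01 <-] xc]] := cc _ (nbhs_prefix c k).
  by exists x => //; rewrite in_itv /= in x01.
pose x k := s2val (cid2 (H k)).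
have x01 k : 0 <= x k < 1 by rewrite /x; case: cid2.
have xc k i : (i < k)%N -> beta_expansion beta (x k) i = c i.
  by move=> ik; exact: (s2valP' (cid2 (H k)) i ik).
apply: (@closed_cvg _ {ptws nat -> nat} \oo _
  (fun k => beta_expansion beta (x k)) (beta_shift beta)).
- exact: closed_closure.
- apply: nearW => k; apply: subset_closure; exists (x k) => //=.
  by rewrite in_itv /=.
- apply/pointwise_cvgP => i; apply: cvg_near_cst.
  by exists i.+1 => // k /= ik; apply: xc.
Qed.

Lemma beta_expansion_shift (x : R) : 0 <= x < 1 ->
  beta_shift beta (beta_expansion beta x).
Proof. by move=> x01; apply/beta_shiftP => k; exists x. Qed.

Lemma beta_shift_shift (beta_gt1 : 1 < beta) (c : nat -> nat) k :
  beta_shift beta c -> beta_shift beta (fun i => c (k + i)%N).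
Proof.
move=> /beta_shiftP cb; apply/beta_shiftP => l.
have [x x01 xc] := cb (k + l)%N.
exists (iter k (beta_transform beta) x); first exact: iter_beta_transform_itv.
move=> i il; rewrite -xc ?ltn_add2l//.
by rewrite /beta_expansion addnC iterD.
Qed.

Lemma compact_beta_shift n :
  compact [set c : {ptws nat -> nat} |
    beta_shift beta c /\ forall i, (c i < n)%N].
Proof.
have C : compact [set c : {ptws nat -> nat} | forall i, `I_n (c i)].
  apply: (@tychonoff nat (fun=> nat) (fun=> `I_n)) => _.
  by apply: finite_compact; exact: finite_II.
have -> : [set c : {ptws nat -> nat} |
    beta_shift beta c /\ forall i, (c i < n)%N] =
    [set c : {ptws nat -> nat} | forall i, `I_n (c i)] `&` beta_shift beta.
  by apply/seteqP; split=> c [].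
by apply: compact_closedI => //; exact: closed_closure.
Qed.

End BetaShift.

(** * Geometric decay and bounded distances *)

Lemma near_geometric_lt (R : realType) (r M e : R) : 0 < r -> r < 1 -> 0 < e ->
  \forall k \near \oo, r ^+ k * M < e.
Proof.
move=> r0 r1 e0.
have : geometric M r @ \oo --> (0 : R).
  by apply: cvg_geometric; rewrite ger0_norm// ltW.
move=> /cvgrPdist_lt /(_ e e0); apply: filterS => k.
by rewrite sub0r normrN /geometric /= mulrC => /(le_lt_trans (ler_norm _)).
Qed.

Lemma ler_geometric_le0 (R : realType) (r a M : R) : 0 < r -> r < 1 ->
  (forall k, a <= r ^+ k * M) -> a <= 0.
Proof.
move=> r0 r1 aM; apply/ler_addgt0Pl => e e0; rewrite addr0.
have [k _ /(_ k (leqnn k)) /= ke] := near_geometric_lt M r0 r1 e0.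
by rewrite (le_trans (aM k))// ltW.
Qed.

Lemma powR_exprAC (R : realType) (a t : R) k : 0 <= a ->
  (a ^+ k) `^ t = (a `^ t) ^+ k.
Proof. by move=> a0; rewrite -!powR_mulrn ?powR_ge0// powRAC. Qed.

Lemma mdist_continuous (R : realType) (X : metricType R) :
  continuous (fun p : X * X => mdist p.1 p.2).
Proof.
move=> [x y]; apply/cvgrPdist_le => e e0.
have e2 : 0 < e / 2 by rewrite divr_gt0.
exists (ball x (e / 2), ball y (e / 2)).
  by split; apply: nbhsx_ballx.
move=> [x' y'] /= []; rewrite !ballEmdist /= => xx' yy'.
have := metric_triangle x x' y; have := metric_triangle x' y' y.
have := metric_triangle x' x y'; have := metric_triangle x y y'.
rewrite (metric_sym x' x) (metric_sym y' y) => h1 h2 h3 h4.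
by rewrite ler_norml; lra.
Qed.

(** The bound is taken positive even if the space has a single point, so that
    it can be raised to any power. *)
Lemma compact_mdist_bounded (R : realType) (X : metricType R) :
  compact [set: X] -> exists2 D : R, 1 <= D & forall x y : X, mdist x y <= D.
Proof.
move=> cX; have [[x0 _]|X0] := pselect (exists x : X, True); last first.
  by exists 1 => // x; exfalso; apply: X0; exists x.
have [c _ cm] : exists2 c, c \in [set: X] `*` [set: X] &
    forall t, t \in [set: X] `*` [set: X] ->
      mdist (t : X * X).1 t.2 <= mdist (c : X * X).1 c.2.
  apply: compact_EVT_max => //; first by exists (x0, x0).
    exact: compact_setX.
  by apply: continuous_subspaceT; exact: mdist_continuous.
exists (1 + mdist c.1 c.2) => [|x y]; first by rewrite lerDl mdist_ge0.
by rewrite ler_wpDl// (cm (x, y))// inE.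
Qed.

(** * The coding map *)

Section CodingMap.
Import metricType_numDomainType.
Context {R : realType} {X : metricType R} {n : nat}.
Context (f : 'I_n -> X -> X) (r D : R) (x0 : X).
Context (X_compact : compact [set: X]).
Context (r_gt0 : 0 < r).
Context (r_lt1 : r < 1).
Context (f_similarity : forall (i : 'I_n) (x y : X),
  mdist (f i x) (f i y) = r * mdist x y).
Context (X_bounded : forall x y : X, mdist x y <= D).
Implicit Types (w : nat -> 'I_n) (x y : X).

Lemma ifs_comp_dist w k x y :
  mdist (ifs_comp f w k x) (ifs_comp f w k y) = r ^+ k * mdist x y.
Proof.
elim: k x y => [|k IH] x y /=; first by rewrite expr0 mul1r.
by rewrite IH f_similarity exprSr mulrA.
Qed.

Lemma eq_ifs_comp w w' k : (forall i, (i < k)%N -> w i = w' i) ->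
  ifs_comp f w k = ifs_comp f w' k.
Proof.
elim: k => [//|k IH] ww' /=; rewrite ww'// IH// => i ik.
by apply: ww'; rewrite ltnW.
Qed.

Lemma ifs_compD w k m :
  ifs_comp f w (k + m) = ifs_comp f w k \o ifs_comp f (fun i => w (k + i)%N) m.
Proof.
elim: m => [|m IH]; first by rewrite addn0.
by rewrite addnS /= IH.
Qed.

Lemma ifs_comp_dist_le w k x y :
  mdist (ifs_comp f w k x) (ifs_comp f w k y) <= r ^+ k * D.
Proof. by rewrite ifs_comp_dist ler_wpM2l// exprn_ge0// ltW. Qed.

Lemma ifs_comp_cauchy w k m : (k <= m)%N ->
  mdist (ifs_comp f w k x0) (ifs_comp f w m x0) <= r ^+ k * D.
Proof. by move=> /subnKC <-; rewrite ifs_compD /= ifs_comp_dist_le. Qed.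

(** A cluster point of the orbit is at distance at most [r ^+ k * D] from its
    [k]-th term, since so are all later terms: hence it is the limit. *)
Lemma ifs_comp_cvg w : exists y, ifs_comp f w k x0 @[k --> \oo] --> y.
Proof.
have [y [_ yc]] :=
  @X_compact (ifs_comp f w k x0 @[k --> \oo]) _ filterT.
exists y; apply/cvgrPdist_le => e e0.
have e2 : 0 < e / 2 by rewrite divr_gt0.
apply: filterS (near_geometric_lt D r_gt0 r_lt1 e2) => k rDk.
have [z [yz zk]] : (ball y (e / 2) `&`
    [set z | mdist (ifs_comp f w k x0) z <= r ^+ k * D]) !=set0.
  rewrite setIC; apply: yc; last by exact: nbhsx_ballx.
  by exists k => // m /=; apply: ifs_comp_cauchy.
rewrite ballEmdist /= in yz; rewrite /= metric_sym in zk.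
rewrite (le_trans (metric_triangle _ z _))// [leRHS]splitr lerD// ?ltW//.
exact: le_lt_trans rDk.
Qed.

Lemma coding_map_cvg w : ifs_comp f w k x0 @[k --> \oo] --> coding_map f x0 w.
Proof. exact: (xgetPex x0 (ifs_comp_cvg w)). Qed.

Lemma coding_map_dist w k :
  mdist (ifs_comp f w k x0) (coding_map f x0 w) <= r ^+ k * D.
Proof.
apply/ler_addgt0Pl => e e0.
have /cvgrPdist_le /(_ e e0) [m _ cm] := @coding_map_cvg w.
have /= := cm (maxn k m); rewrite leq_maxr => /(_ isT) kme.
rewrite (le_trans (metric_triangle _ (ifs_comp f w (maxn k m) x0) _))//.
by rewrite addrC lerD// ?ifs_comp_cauchy ?leq_maxl// metric_sym.
Qed.

Lemma coding_map_unique w y : (exists K M,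
    forall k, mdist (ifs_comp f w (K + k) x0) y <= r ^+ k * M) ->
  coding_map f x0 w = y.
Proof.
move=> [K [M yM]]; apply: mdist_positivity.
apply/eqP; rewrite eq_le mdist_ge0 andbT.
apply: (@ler_geometric_le0 _ r _ (D + M)) => // k.
rewrite (le_trans (metric_triangle _ (ifs_comp f w (K + k) x0) _))// mulrDr.
rewrite lerD// metric_sym (le_trans (coding_map_dist _ _))//.
rewrite ler_wpM2r ?(le_trans (mdist_ge0 x0 x0))//.
by rewrite ler_wiXn2l ?leq_addl// ltW.
Qed.

(** Self-similarity of the coding map: past its first [k] symbols, the orbit
    of [w] is the image under the first [k] maps of the orbit of the shifted
    code, so the same holds for the limits. *)
Lemma coding_map_split w k :
  coding_map f x0 w =
    ifs_comp f w k (coding_map f x0 (fun i => w (k + i)%N)).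
Proof.
apply: coding_map_unique; exists k, D => m.
rewrite ifs_compD /= ifs_comp_dist.
apply: le_trans (coding_map_dist (fun i => w (k + i)%N) m).
by rewrite ler_piMl ?mdist_ge0// exprn_ile1// ltW.
Qed.

Lemma coding_map_lipschitz w w' k : (forall i, (i < k)%N -> w i = w' i) ->
  mdist (coding_map f x0 w) (coding_map f x0 w') <= r ^+ k * D.
Proof.
move=> ww'; rewrite (coding_map_split w k) (coding_map_split w' k).
by rewrite (eq_ifs_comp ww') ifs_comp_dist_le.
Qed.

Lemma coding_map_dist_tail w w' k : (forall i, (i < k)%N -> w i = w' i) ->
  mdist (coding_map f x0 w) (coding_map f x0 w') =
  r ^+ k * mdist (coding_map f x0 (fun i => w (k + i)%N))
                 (coding_map f x0 (fun i => w' (k + i)%N)).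
Proof.
move=> ww'; rewrite (coding_map_split w k) (coding_map_split w' k).
by rewrite (eq_ifs_comp ww') ifs_comp_dist.
Qed.

End CodingMap.

(** * Hausdorff measure *)

Section HausdorffMeasure.
Local Open Scope ereal_scope.
Context {R : realType} {X : metricType R}.
Implicit Types (A E : set X) (s t d c : R).

Lemma diam_ge A x y : A x -> A y -> (mdist x y)%:E <= diam A.
Proof. by move=> Ax Ay; apply: ereal_sup_ubound; exists (x, y). Qed.

Lemma diam_le A c : (forall x y, A x -> A y -> (mdist x y <= c)%R) ->
  diam A <= c%:E.
Proof.
move=> Ac; apply: ge_ereal_sup => _ [[x y] [/= Ax Ay] <-].
by rewrite lee_fin Ac.
Qed.

Lemma diam_ge0 A : A !=set0 -> 0 <= diam A.
Proof. by move=> [x Ax]; rewrite (le_trans _ (diam_ge Ax Ax))// mdistxx. Qed.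

Lemma diam_pow_ge0 s A : 0 <= diam_pow s A.
Proof. by rewrite /diam_pow; case: ifP => // _; exact: poweR_ge0. Qed.

Lemma diam_pow_le s A c : (0 <= s)%R -> (0 <= c)%R ->
    (forall x y, A x -> A y -> (mdist x y <= c)%R) ->
  diam_pow s A <= (c `^ s)%:E.
Proof.
move=> s0 c0 Ac; rewrite /diam_pow; case: ifPn => [_|/set0P A0].
  by rewrite lee_fin powR_ge0.
rewrite -poweR_EFin; apply: gt0_ler_poweR => //.
- by rewrite in_itv /= diam_ge0 // leey.
- by rewrite in_itv /= lee_fin c0 leey.
- exact: diam_le.
Qed.

Lemma le_hausdorff_premeasure s d d' E : (d <= d')%R ->
  hausdorff_premeasure s d' E <= hausdorff_premeasure s d E.
Proof.
move=> dd'; apply: ereal_inf_le_tmp => _ [U [EU Ud] <-]; exists U => //.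
by split=> // i; rewrite (le_trans (Ud i))// lee_fin.
Qed.

(** The premeasures can only grow when the scale shrinks, since fewer covers
    compete: their limit at 0 is a supremum, and always exists. *)
Lemma hausdorff_measureE s E : hausdorff_measure s E =
  ereal_sup [set hausdorff_premeasure s d E | d in `]0%R, +oo[].
Proof.
apply/cvg_lim => //; apply: nonincreasing_at_right_cvge => //.
by move=> d d' _ _; exact: le_hausdorff_premeasure.
Qed.

Lemma hausdorff_measure_ge s d E : (0 < d)%R ->
  hausdorff_premeasure s d E <= hausdorff_measure s E.
Proof.
move=> d0; rewrite hausdorff_measureE; apply: ereal_sup_ubound.
by exists d => //=; rewrite in_itv /= d0.
Qed.

Lemma hausdorff_measure_le s E M :
    (forall d, (0 < d)%R -> hausdorff_premeasure s d E <= M) ->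
  hausdorff_measure s E <= M.
Proof.
move=> EM; rewrite hausdorff_measureE; apply: ge_ereal_sup => _ [d /= + <-].
by rewrite in_itv /= andbT; exact: EM.
Qed.

Lemma hausdorff_measure_ge0 s E : 0 <= hausdorff_measure s E.
Proof.
apply: le_trans (hausdorff_measure_ge s E ltr01).
apply: le_ereal_inf_tmp => _ [U _ <-]; apply: nneseries_ge0 => i _ _.
exact: diam_pow_ge0.
Qed.

Lemma hausdorff_premeasure_le (N : nat) (U : nat -> set X) s c d E :
    (0 <= s)%R -> (0 <= c <= d)%R -> E `<=` \bigcup_(i in `I_N) U i ->
    (forall i x y, U i x -> U i y -> (mdist x y <= c)%R) ->
  hausdorff_premeasure s d E <= (N%:R * c `^ s)%:E.
Proof.
move=> s0 /andP[c0 cd] EU Uc.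
pose V i := if (i < N)%N then U i else set0.
have Vc i x y : V i x -> V i y -> (mdist x y <= c)%R.
  by rewrite /V; case: ifP => // _; exact: Uc.
apply: (@le_trans _ _ (\sum_(0 <= i <oo) diam_pow s (V i))).
  apply: ereal_inf_lbound; exists V => //; split.
    move=> x /EU [i /= iN Ux]; exists i => //; by rewrite /V iN.
  by move=> i; apply: diam_le => x y Vx Vy; rewrite (le_trans (Vc i x y Vx Vy)).
(* Past [N] the cover is padded with empty sets, which weigh nothing. *)
rewrite (@nneseries_split _ _ 0 N); last by move=> *; exact: diam_pow_ge0.
rewrite add0n eseries0 => [|i Ni _]; last first.
  by rewrite /V ltnNge Ni /= /diam_pow eqxx.
rewrite adde0 mulr_natl.
apply: (@le_trans _ _ (\sum_(0 <= i < N) (c `^ s)%:E)).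
  by apply: lee_sum => i _; apply: diam_pow_le => //; exact: Vc.
by rewrite sumEFin sumr_const_nat subn0.
Qed.

(** The mass distribution principle for Lebesgue measure on [0, 1): each set
    of a cover of [E] pulls back along [p] into an interval of length at most
    [2 * c * diam ^ s], and these intervals cover [0, 1). *)
Lemma hausdorff_premeasure_ge (p : R -> X) s t c d E :
    (0 < s)%R -> (0 <= t <= s)%R -> (0 < c)%R -> (d <= 1)%R ->
    (forall x, (0 <= x < 1)%R -> E (p x)) ->
    (forall x y, (0 <= x < 1)%R -> (0 <= y < 1)%R ->
      (`|x - y| <= c * mdist (p x) (p y) `^ s)%R) ->
  ((2 * c)^-1)%:E <= hausdorff_premeasure t d E.
Proof.
move=> s0 /andP[t0 ts] c0 d1 Ep holder.
apply: le_ereal_inf_tmp => _ [U [EU Ud] <-].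
pose q i : R := fine (diam (U i)).
pose a i : R := xget 0%R [set x | (0 <= x < 1)%R /\ U i (p x)].
(* A ball around a point of the pulled back set contains it, at the price of a
   factor 2 in the length. *)
pose B i : set R := if U i == set0 then set0 else
  `[(a i - c * q i `^ s)%R, (a i + c * q i `^ s)%R]%classic.
have qE i : U i !=set0 -> diam (U i) = (q i)%:E.
  move=> U0; rewrite fineK// ge0_fin_numE ?diam_ge0//.
  by rewrite (le_lt_trans (Ud i))// ltry.
have q0 i : U i !=set0 -> (0 <= q i)%R.
  by move=> U0; rewrite -lee_fin -qE// diam_ge0.
have q1 i : U i !=set0 -> (q i <= 1)%R.
  by move=> U0; rewrite -lee_fin -qE// (le_trans (Ud i))// lee_fin.
have BU : `[0%R, 1%R[%classic `<=` \bigcup_i B i.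
  move=> x /=; rewrite in_itv /= => x01.
  have [i _ Ux] := EU _ (Ep _ x01); exists i => //.
  have U0 : U i !=set0 by exists (p x).
  have [a01 Ua] : (0 <= a i < 1)%R /\ U i (p (a i)).
    exact: (@xgetPex _ 0%R [set x | (0 <= x < 1)%R /\ U i (p x)]
      (ex_intro _ x (conj x01 Ux))).
  rewrite /B; case: ifPn => [/eqP Ui|_]; first by rewrite Ui in Ux.
  rewrite /= in_itv /= -ler_distl (le_trans (holder _ _ x01 a01))//.
  rewrite ler_pM2l// ge0_ler_powR ?nnegrE ?mdist_ge0 ?q0// ?(ltW s0)//.
  by rewrite -lee_fin -qE// diam_ge.
have B_le i : lebesgue_measure (B i) <= (2 * c)%:E * diam_pow t (U i).
  rewrite /B /diam_pow; case: ifPn => [_|/set0P U0].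
    by rewrite measure0 mule0.
  rewrite lebesgue_measure_itv /= qE// poweR_EFin -EFinM.
  have cq : (0 <= c * q i `^ s)%R by rewrite mulr_ge0 ?powR_ge0 ?ltW.
  (* Diameters at most 1 have smaller powers at larger exponents; for [q i = 0]
     this uses [0 < s], as [0 `^ 0 = 1]. *)
  have qst : (q i `^ s <= q i `^ t)%R.
    have := q0 i U0; rewrite le_eqVlt => /orP[/eqP <-|qi0].
      by rewrite powR0 ?gt_eqF// powR_ge0.
    by apply: ger_powR => //; rewrite qi0 q1.
  have cqt : (c * q i `^ s <= c * q i `^ t)%R by rewrite ler_pM2l.
  case: ifPn => _; rewrite -?EFinB lee_fin; lra.
rewrite -[leRHS]mul1e.
have -> : 1 = ((2 * c)^-1)%:E * (2 * c)%:E :> \bar R.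
  by rewrite -EFinM mulVf// gt_eqF// mulr_gt0.
rewrite -muleA -[leLHS]mule1.
apply: lee_wpmul2l; first by rewrite lee_fin invr_ge0 mulr_ge0// ltW.
rewrite -nneseriesZl => [|i _]; last exact: diam_pow_ge0.
have mB i : measurable (B i) by rewrite /B; case: ifP => // _; exact: measurable_itv.
apply: (@le_trans _ _ (\sum_(0 <= i <oo) lebesgue_measure (B i))); last first.
  by apply: lee_nneseries => i *; [exact: measure_ge0|exact: B_le].
have -> : 1 = lebesgue_measure (`[0%R, 1%R[%classic : set R) :> \bar R.
  by rewrite lebesgue_measure_itv /= lte_fin ltr01 sube0.
exact: measure_sigma_subadditive.
Qed.

End HausdorffMeasure.

(** * The beta-attractor *)

Section Attractor.
Import metricType_numDomainType.
Context {R : realType} {X : metricType R} {n : nat}.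
Context (f : 'I_n -> X -> X) (r beta D : R) (x0 : X).
Context (X_compact : compact [set: X]).
Context (r_gt0 : 0 < r).
Context (r_lt1 : r < 1).
Context (f_similarity : forall (i : 'I_n) (x y : X),
  mdist (f i x) (f i y) = r * mdist x y).
Context (D_ge1 : 1 <= D).
Context (X_bounded : forall x y : X, mdist x y <= D).
Context (beta_gt1 : 1 < beta).
Context (beta_ltn : beta < n%:R).
Implicit Types (w : nat -> 'I_n) (x y : X).

Let E := beta_attractor f x0 beta.
Let phi := coding_map f x0.

Let n_gt0 : (0 < n)%N.
Proof. by rewrite -(ltr_nat R) (lt_trans _ beta_ltn)// (lt_trans _ beta_gt1). Qed.

(** The topology in which the beta-shift is closed lives on sequences of natural
    numbers; this reads such a sequence as a code, with symbol 0 in place of the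
    digits that are not below [n]. *)
Definition code_of_digits (c : nat -> nat) : nat -> 'I_n :=
  fun k => insubd (Ordinal n_gt0) (c k).

Lemma code_of_digitsE c : (forall k, (c k < n)%N) ->
  (fun k => code_of_digits c k : nat) = c.
Proof. by move=> cn; apply/funext => k; rewrite /code_of_digits val_insubd cn. Qed.

Lemma coding_map_continuous :
  continuous ((fun c => phi (code_of_digits c)) : {ptws nat -> nat} -> X).
Proof.
move=> c; apply/cvgrPdist_le => e e0.
have [k _ /(_ k (leqnn k)) /= ke] := near_geometric_lt D r_gt0 r_lt1 e0.
apply: filterS (nbhs_prefix c k) => c' cc'.
rewrite (le_trans _ (ltW ke))//; apply: coding_map_lipschitz => // i ik.
by rewrite /code_of_digits cc'.
Qed.

Lemma beta_attractorE : E = (fun c => phi (code_of_digits c)) @`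
  [set c : {ptws nat -> nat} | beta_shift beta c /\ forall i, (c i < n)%N].
Proof.
apply/seteqP; split=> [_ [w wb <-]|_ [c [cb cn] <-]].
  exists (fun k => w k : nat); first by split.
  by congr coding_map; apply/funext => k; rewrite /code_of_digits valKd.
by exists (code_of_digits c) => //=; rewrite code_of_digitsE.
Qed.

Lemma compact_beta_attractor : compact E.
Proof.
rewrite beta_attractorE; apply: continuous_compact.
  by apply: continuous_subspaceT; exact: coding_map_continuous.
exact: compact_beta_shift.
Qed.

Lemma similarity_continuous i : continuous (f i).
Proof.
move=> x; apply/cvgrPdist_lt => e e0.
have er0 : 0 < e / r by rewrite divr_gt0.
apply: filterS (nbhsx_ballx x _ er0) => y; rewrite ballEmdist /= f_similarity => xy.
by rewrite mulrC -ltr_pdivlMr.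
Qed.

Lemma coding_map_attractor w k :
  beta_shift beta (fun i => w i : nat) -> E (phi (fun i => w (k + i)%N)).
Proof.
move=> wb; exists (fun i => w (k + i)%N) => //=.
exact: (beta_shift_shift (k := k) beta_gt1 wb).
Qed.

Lemma compact_attractor_piece i : compact (f i @` E `&` E).
Proof.
apply: compact_closedI.
  apply: continuous_compact compact_beta_attractor.
  by apply: continuous_subspaceT; exact: similarity_continuous.
apply: compact_closed compact_beta_attractor; exact: metric_hausdorff.
Qed.

Context (separation : forall i j : 'I_n, i != j ->
  f i @` E `&` f j @` E `&` E = set0).

(** Disjoint compact sets are at positive distance: it is a minimum of the
    distance on their product. *)
Lemma attractor_pieces_dist i j : i != j -> exists2 e : R, 0 < e &
  forall x y, (f i @` E `&` E) x -> (f j @` E `&` E) y -> e <= mdist x y.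
Proof.
move=> ij; set K := (f i @` E `&` E) `*` (f j @` E `&` E).
have [K0|/set0P/negP/negPn/eqP K0] := pselect (K !=set0); last first.
  (* If one of the pieces is empty, any positive bound will do. *)
  exists 1 => // x y Ex Ey; have : K (x, y) by split.
  by rewrite K0.
have [||[x y]] := @compact_EVT_min _ R (fun p : X * X => mdist p.1 p.2) K K0.
- by apply: compact_setX; exact: compact_attractor_piece.
- by apply: continuous_subspaceT; exact: mdist_continuous.
rewrite inE => -[/= [fx Ex] [fjy Ey]] xy_min.
exists (mdist x y) => [|x' y' Ex' Ey']; last by apply: (xy_min (x', y')); rewrite inE.
rewrite mdist_gt0; apply/eqP => xy; rewrite -{}xy in fjy.
by have : (f i @` E `&` f j @` E `&` E) x by []; rewrite separation.
Qed.

(** The gap at the first symbol: codes with different first symbols lie in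
    different pieces, and there are finitely many pairs of pieces. *)
Lemma separation_dist : exists2 e : R, 0 < e & forall w w',
  beta_shift beta (fun i => w i : nat) ->
  beta_shift beta (fun i => w' i : nat) ->
  w 0%N != w' 0%N -> e <= mdist (phi w) (phi w').
Proof.
have pairs (p : 'I_n * 'I_n) : exists e : R, 0 < e /\ (p.1 != p.2 ->
    forall x y, (f p.1 @` E `&` E) x -> (f p.2 @` E `&` E) y ->
      e <= mdist x y).
  have [->|ij] := eqVneq p.1 p.2; first by exists 1.
  by have [e e0 eP] := attractor_pieces_dist ij; exists e.
pose e p := sval (cid (pairs p)); have eP p := svalP (cid (pairs p)).
exists (\big[Num.min/1]_p e p).
  by apply: lt_bigmin => // p _; have [] := eP p.
have piece w : beta_shift beta (fun i => w i : nat) ->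
    (f (w 0%N) @` E `&` E) (phi w).
  move=> wb; split; last exact: (coding_map_attractor 0 wb).
  exists (phi (fun i => w (1 + i)%N)); first exact: coding_map_attractor.
  exact/esym/(coding_map_split x0 X_compact r_gt0 r_lt1 f_similarity
    X_bounded w 1).
move=> w w' wb wb' ww'; have [_ /(_ ww') ee] := eP (w 0%N, w' 0%N).
apply: le_trans (ee _ _ (piece _ wb) (piece _ wb')).
exact: bigmin_le_cond.
Qed.

(** The exponent that makes the two scales of a prefix of length [k] agree:
    [(r ^+ k) `^ s = beta ^- k], a distance in the attractor against a length in
    [0, 1). *)
Let s := ln beta / - ln r.

Lemma ln_ratio_lt0 : ln r < 0. Proof. by rewrite ln_lt0// r_gt0. Qed.

Lemma similarity_dim_gt0 : 0 < s.
Proof. by rewrite divr_gt0 ?ln_gt0 ?oppr_gt0 ?ln_ratio_lt0. Qed.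

Lemma powR_similarity_dim : r `^ s = beta^-1.
Proof.
rewrite /powR gt_eqF// /s -mulrA invrN mulNr mulVf ?lt_eqF ?ln_ratio_lt0//.
by rewrite mulrN1 expRN lnK// posrE (lt_trans _ beta_gt1).
Qed.

(** Cut at the first position [k] where the two expansions differ: the left side
    is at most [beta ^- k], and self-similarity reduces the distance on the right
    to the gap [e], scaled by [r ^+ k]. *)
Lemma expansion_holder (e : R) (x y : R) : 0 < e ->
    (forall w w', beta_shift beta (fun i => w i : nat) ->
      beta_shift beta (fun i => w' i : nat) ->
      w 0%N != w' 0%N -> e <= mdist (phi w) (phi w')) ->
    0 <= x < 1 -> 0 <= y < 1 ->
  `|x - y| <= (e `^ s)^-1 *
    mdist (phi (code_of_digits (beta_expansion beta x)))
          (phi (code_of_digits (beta_expansion beta y))) `^ s.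
Proof.
move=> e0 esep x01 y01.
have es0 : 0 < e `^ s by rewrite powR_gt0.
have bE z : 0 <= z < 1 -> (fun k =>
    code_of_digits (beta_expansion beta z) k : nat) = beta_expansion beta z.
  by move=> z01; apply: code_of_digitsE => k; exact: beta_expansion_ltn.
have bsh z : 0 <= z < 1 -> beta_shift beta (fun k =>
    code_of_digits (beta_expansion beta z) k : nat).
  by move=> z01; rewrite bE//; exact: beta_expansion_shift.
(* Two points with the same expansion coincide. *)
have [xy|/existsNP xy] := pselect (forall k,
    beta_expansion beta x k = beta_expansion beta y k).
  apply: (@le_trans _ _ 0).
    apply: (@ler_geometric_le0 _ beta^-1 _ 1).
    - by rewrite invr_gt0 (lt_trans _ beta_gt1).
    - by rewrite invf_lt1// (lt_trans _ beta_gt1).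
    - by move=> k; rewrite mulr1 exprVn; exact: beta_expansion_dist.
  by rewrite mulr_ge0 ?powR_ge0// invr_ge0 ltW.
have {}xy : exists k, beta_expansion beta x k != beta_expansion beta y k.
  by have [k /eqP] := xy; exists k.
case: (ex_minnP xy) => k xyk kmin.
have agree i : (i < k)%N -> beta_expansion beta x i = beta_expansion beta y i.
  by apply: contraTeq => /kmin; rewrite -leqNgt.
apply: (le_trans (beta_expansion_dist beta_gt1 x01 y01 agree)).
rewrite mulrC ler_pdivlMr// -exprVn -powR_similarity_dim -powR_exprAC ?(ltW r_gt0)//.
rewrite -powRM ?exprn_ge0 ?(ltW r_gt0) ?(ltW e0)//.
have rke : 0 <= r ^+ k * e by rewrite mulr_ge0 ?exprn_ge0 ?(ltW e0) ?(ltW r_gt0).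
apply: ge0_ler_powR; rewrite ?nnegrE ?mdist_ge0 ?(ltW similarity_dim_gt0)//.
have agree_code i : (i < k)%N -> code_of_digits (beta_expansion beta x) i =
    code_of_digits (beta_expansion beta y) i.
  by move=> ik; rewrite /code_of_digits agree.
rewrite /phi (coding_map_dist_tail x0 X_compact r_gt0 r_lt1 f_similarity
  X_bounded agree_code).
rewrite ler_pM2l ?exprn_gt0//; apply: esep.
- exact: (beta_shift_shift (k := k) beta_gt1 (bsh x x01)).
- exact: (beta_shift_shift (k := k) beta_gt1 (bsh y y01)).
- rewrite addn0 -val_eqE /=; apply: contra xyk => /eqP.
  by move: (congr1 (@^~ k) (bE x x01)) (congr1 (@^~ k) (bE y y01)) => /= -> -> ->.
Qed.

(** One constant serves for all exponents below the similarity dimension, as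
    at scale 1 the powers of a diameter decrease with the exponent. *)
Lemma premeasure_attractor_ge : exists2 c : R, 0 < c &
  forall t, 0 <= t <= s -> (c%:E <= hausdorff_premeasure t 1 E)%E.
Proof.
have [e e0 esep] := separation_dist.
exists (2 * (e `^ s)^-1)^-1; first by rewrite invr_gt0 mulr_gt0 ?invr_gt0 ?powR_gt0.
move=> t ts; apply: (@hausdorff_premeasure_ge _ _
    (fun x : R => phi (code_of_digits (beta_expansion beta x))) s) => //.
- exact: similarity_dim_gt0.
- by rewrite invr_gt0 powR_gt0.
- move=> x x01; exists (code_of_digits (beta_expansion beta x)) => //=.
  rewrite code_of_digitsE; first exact: beta_expansion_shift.
  by move=> k; exact: beta_expansion_ltn.
- by move=> x y; exact: expansion_holder.
Qed.

(** Cover by the codes sharing a prefix of length [k]. The factor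
    [beta / (beta - 1)] comes from the number of prefixes and [D] bounds the
    diameter of the whole space. *)
Lemma premeasure_attractor_le t d k : 0 <= t -> r ^+ k * D <= d ->
  (hausdorff_premeasure t d E <=
    ((beta * r `^ t) ^+ k * (beta / (beta - 1) * D `^ t))%:E)%E.
Proof.
move=> t0 kd.
have D0 : 0 < D by exact: lt_le_trans D_ge1.
have b0 : 0 < beta by exact: lt_trans beta_gt1.
have bm : 0 < beta - 1 by rewrite subr_gt0.
have [|L sL Lx] := @beta_prefixes R beta beta_gt1 k 1; first by rewrite ler01 lexx.
(* The shift has no other prefixes than the expansions themselves. *)
have EL : E `<=` \bigcup_(i in `I_(size L))
    (phi @` [set w : nat -> 'I_n | mkseq (fun j => w j : nat) k = nth [::] L i]).
  move=> _ [w wb <-].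
  have [x /andP[x00 x1] xw] := (beta_shiftP beta (fun j => w j : nat)).1 wb k.
  have wL : mkseq (fun j => w j : nat) k \in L.
    have -> : mkseq (fun j => w j : nat) k = mkseq (beta_expansion beta x) k.
      by apply/eq_in_map => j; rewrite mem_iota /= => jk; rewrite xw.
    by apply: Lx; rewrite x00.
  exists (index (mkseq (fun j => w j : nat) k) L); first by rewrite /= index_mem.
  by exists w => //=; rewrite nth_index.
apply: (@le_trans _ _ ((size L)%:R * (r ^+ k * D) `^ t)%:E).
  apply: hausdorff_premeasure_le EL _ => //.
    by rewrite kd mulr_ge0 ?exprn_ge0// ltW.
  move=> i _ _ [w /= wL <-] [w' /= wL' <-]; apply: coding_map_lipschitz => // j jk.
  apply: val_inj => /=.
  by rewrite -(nth_mkseq 0%N (fun j => w j : nat) jk) wL -wL' nth_mkseq.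
rewrite lee_fin powRM ?exprn_ge0 ?(ltW D0) ?(ltW r_gt0)//.
rewrite powR_exprAC ?(ltW r_gt0)// exprMn mulrA.
rewrite [leRHS]mulrA ler_wpM2r ?powR_ge0// mulrAC ler_wpM2r ?exprn_ge0 ?powR_ge0//.
rewrite (le_trans sL)// mul1r mulrBr mulr1 [leRHS]mulrC -addrA gerDl.
by rewrite addrC subr_le0 ler_pdivlMr// mul1r gerBl.
Qed.

Lemma measure_attractor_lty : (hausdorff_measure s E < +oo)%E.
Proof.
apply: (@le_lt_trans _ _ (beta / (beta - 1) * D `^ s)%:E); last exact: ltry.
apply: hausdorff_measure_le => d d0.
have [k _ /(_ k (leqnn k)) /= kd] := near_geometric_lt D r_gt0 r_lt1 d0.
apply: (le_trans (premeasure_attractor_le (ltW similarity_dim_gt0) (ltW kd))).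
rewrite powR_similarity_dim mulfV ?gt_eqF ?(lt_trans _ beta_gt1)//.
by rewrite expr1n mul1r.
Qed.

(** Above the similarity dimension the ratio [beta * r `^ t] is smaller than 1,
    so that the bound on the premeasure tends to 0 with the mesh of the cover. *)
Lemma measure_attractor_eq0 t : s < t -> hausdorff_measure t E = 0%E.
Proof.
move=> st; apply/eqP; rewrite eq_le hausdorff_measure_ge0 andbT.
apply/lee_addgt0Pr => e e0; rewrite add0e; apply: hausdorff_measure_le => d d0.
have b0 : 0 < beta by exact: lt_trans beta_gt1.
have q0 : 0 < beta * r `^ t by rewrite mulr_gt0// powR_gt0.
have q1 : beta * r `^ t < 1.
  rewrite -ltr_pdivlMl// mulr1 -powR_similarity_dim /powR gt_eqF// ltr_expR.
  by rewrite ltr_nM2r// ln_ratio_lt0.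
near \oo => k.
apply: (@le_trans _ _
    ((beta * r `^ t) ^+ k * (beta / (beta - 1) * D `^ t))%:E).
  apply: premeasure_attractor_le; first by rewrite ltW// (lt_trans similarity_dim_gt0).
  by apply/ltW; near: k; exact: near_geometric_lt.
by rewrite lee_fin; apply/ltW; near: k; exact: near_geometric_lt.
Unshelve. all: by end_near. Qed.

Lemma measure_attractor_gt0 t : 0 <= t <= s -> (0 < hausdorff_measure t E)%E.
Proof.
move=> ts; have [c c0 cE] := premeasure_attractor_ge.
by rewrite (lt_le_trans _ (hausdorff_measure_ge t E ltr01))// (lt_le_trans _ (cE t ts)).
Qed.

Lemma hausdorff_dim_attractor : hausdorff_dim E = s%:E.
Proof.
apply/eqP; rewrite eq_le; apply/andP; split.
  apply/lee_addgt0Pr => e e0; apply: ereal_inf_lbound; exists (s + e) => //=.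
  split; first by rewrite addr_ge0 ?(ltW similarity_dim_gt0) ?(ltW e0).
  by apply: measure_attractor_eq0; rewrite ltrDl.
apply: le_ereal_inf_tmp => _ [t [t0 Et] <-]; rewrite lee_fin leNgt.
apply/negP => ts; have := @measure_attractor_gt0 t.
by rewrite t0 (ltW ts) Et ltxx => /(_ isT).
Qed.

End Attractor.

Unset Implicit Arguments.

Theorem theorem1 (R : realType) (X : metricType R) (x0 : X)
    (n : nat) (f : 'I_n -> X -> X) (r beta : R)
    (n_ge2 : (2 <= n)%N)
    (X_compact : compact [set: X])
    (r_gt0 : 0 < r) (r_lt1 : r < 1)
    (f_similarity : forall (i : 'I_n) (x y : X),
        mdist (f i x) (f i y) = r * mdist x y)
    (beta_gt1 : 1 < beta) (beta_ltn : beta < n%:R)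
    (separation : forall i j : 'I_n, i != j ->
        f i @` beta_attractor f x0 beta `&` f j @` beta_attractor f x0 beta
          `&` beta_attractor f x0 beta = set0) :
  hausdorff_dim (beta_attractor f x0 beta) = (ln beta / - ln r)%:E /\
  (let s := fine (hausdorff_dim (beta_attractor f x0 beta)) in
   0 < hausdorff_measure s (beta_attractor f x0 beta) < +oo)%E.
Proof.
have [D D1 XD] := compact_mdist_bounded X_compact.
have dimE := hausdorff_dim_attractor X_compact r_gt0 r_lt1 f_similarity D1 XD
  beta_gt1 beta_ltn separation.
split=> //; rewrite dimE /=; apply/andP; split.
  apply: (measure_attractor_gt0 X_compact r_gt0 r_lt1 f_similarity XD
    beta_gt1 beta_ltn separation).
  by rewrite lexx andbT divr_ge0 ?ln_ge0 ?oppr_ge0 ?ln_le0 // ltW.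
exact: (measure_attractor_lty x0 X_compact r_gt0 r_lt1 f_similarity D1 XD
  beta_gt1).
Qed.
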